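(* For every $n\ge2$, $Fl_n^{\ge 0}=\{F\in Fl_n:\ P_I(F)\ge 0 \text{ for all } I\subset[n]\}$; that is, a complete flag lies in Lusztig's totally non-negative complete flag variety if and only if it has non-negative Plücker coordinates.
   Context: A complete flag in $\mathbb R^n$ is a chain $\{0\}=V_0\subsetneq V_1\subsetneq\cdots\subsetneq V_n=\mathbb R^n$ of linear subspaces; $Fl_n$ is the set of complete flags. A flag is represented by an invertible real $n\times n$ matrix $M$ whose first $i$ rows span $V_i$ for each $i$; two matrices represent the same flag iff they differ by left multiplication by an invertible lower triangular matrix. For $I\subset[n]$, the Plücker coordinate $P_I(M)$ is the determinant of the submatrix of $M$ in rows $\{1,\dots,|I|\}$ and columns $I$. We say $P_I(F)\ge0$ for all $I$ if some matrix representative $M$ of $F$ satisfies $P_I(M)\ge 0$ for all $I\subset[n]$. Lusztig's TNN flag variety: for $1\le k<n$ and $a\in\mathbb R$, $x_k(a)$ is the $n\times n$ identity matrix with an extra entry $a$ in row $k$, column $k+1$. Let $s_i=(i,i+1)\in S_n$, $N=\binom n2$, and choose $(i_1,\dots,i_N)$ with $s_{i_1}\cdots s_{i_N}=w_0$, the longest permutation of $S_n$. Let $U^+_{>0}=\{x_{i_1}(a_1)\cdots x_{i_N}(a_N): a_1,\dots,a_N>0\}$ (this set does not depend on the choice). Then $Fl_n^{\ge0}$ is the closure in $Fl_n$ (Euclidean topology) of the set of flags represented by matrices in $U^+_{>0}$. *)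

(* Defs.v *)
From HB Require Import structures.
From mathcomp Require Import all_boot all_order all_algebra perm.
From mathcomp Require Import all_classical all_reals topology normedtype matrix_topology matrix_normedtype.
Set Implicit Arguments. Unset Strict Implicit. Unset Printing Implicit Defensive.
Import Order.TTheory GRing.Theory Num.Theory.
Import numFieldNormedType.Exports.
Local Open Scope ring_scope.
Local Open Scope classical_set_scope.

Section Flags.
Variable R : realType.

Lemma card_set_ord_le n (I : {set 'I_n}) : (#|I| <= n)%N.
Proof. by apply: leq_trans (max_card _) _; rewrite card_ord. Qed.

(* Pluecker coordinate P_I(M): determinant of the submatrix of M in rows
   {1..|I|} and columns I (in increasing order, enum_val enumerates I
   increasingly). *)
Definition plucker n (M : 'M[R]_n) (I : {set 'I_n}) : R :=
  \det (\matrix_(i < #|I|, j < #|I|)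
          M (widen_ord (card_set_ord_le I) i) (enum_val j)).

(* Two matrices represent the same flag iff N = L M with L invertible lower
   triangular (is_trig_mx L : forall i j, i < j -> L i j = 0). *)
Definition same_flag n (M N : 'M[R]_n) : Prop :=
  exists L : 'M[R]_n, [/\ is_trig_mx L, L \in unitmx & N = L *m M].

Definition nonneg_plucker n (M : 'M[R]_n) : Prop :=
  exists N : 'M[R]_n, same_flag M N /\ forall I : {set 'I_n}, 0 <= plucker N I.

(* x_k(a) (k 1-indexed): identity plus entry a at row k, column k+1. *)
Definition xmat n (k : nat) (a : R) : 'M[R]_n :=
  \matrix_(i < n, j < n)
    ((i == j)%:R + (if (i.+1 == k) && (j.+1 == k.+1) then a else 0)).

(* simple transposition s_i = (i, i+1) (1-indexed) in S_n *)
Definition s_perm n (i : nat) : 'S_n :=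
  match @insub _ (fun k => (k < n)%N) 'I_n i.-1, @insub _ (fun k => (k < n)%N) 'I_n i with
  | Some a, Some b => tperm a b
  | _, _ => 1%g
  end.

Definition w0 n : 'S_n := perm (@rev_ord_inj n).

Definition reduced_word_w0 n (w : seq nat) : Prop :=
  [/\ all (fun i => (0 < i < n)%N) w, size w = 'C(n, 2)
    & (\prod_(i <- w) s_perm n i)%g = w0 n].

Definition xprod n (w : seq nat) (a : seq R) : 'M[R]_n :=
  foldr (fun p M => xmat n p.1 p.2 *m M) 1%:M (zip w a).

Definition Uplus_pos n (w : seq nat) : set 'M[R]_n :=
  [set u | exists a : seq R, [/\ size a = size w, all (fun x => 0 < x) a
                                & u = xprod n w a]].

(* Open subsets of Fl_n for the quotient topology of GL_n(R) (Euclidean,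
   open in 'M_n) by the lower triangular invertible matrices: represented by
   their preimages, i.e. saturated open sets of invertible matrices. *)
Definition flag_open n (U : set 'M[R]_n) : Prop :=
  [/\ open U, U `<=` [set A | A \in unitmx]
    & forall A B, same_flag A B -> U A -> U B].

(* The flag of M lies in the closure in Fl_n of the flags represented by
   U^+_{>0}: every open neighbourhood of it contains such a flag. *)
Definition tnn_flag n (w : seq nat) (M : 'M[R]_n) : Prop :=
  forall U : set 'M[R]_n, flag_open U -> U M ->
    exists u, @Uplus_pos n w u /\ U u.

End Flags.

(* Main.v *)
(** If the Pluecker coordinates of a flag in the closure had both signs in the
    same degree, so would those of a nearby product of positive [x_k(a)];
    but right multiplication by [x_k(a)] replaces [P_I] by [P_I + a P_I'],
    with [I'] obtained from [I] by the move k+1 -> k (and [P_I] is kept if this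
    move is impossible), so all the coordinates of that product are nonnegative.

    Conversely, adding a small positive multiple of a column to an adjacent one
    keeps nonnegative coordinates nonnegative and, since adjacent moves connect
    all subsets of the same size, can be repeated until all of them are
    positive.  Then Neville elimination, subtracting from each column the
    multiple of its left neighbour that clears the first row, writes the flag as
    a product of [x_k(a)], a > 0, along one particular reduced word of w0; only
    the positivity of the minors on consecutive columns is needed, and it is
    inherited by the next elimination step.  Finally, the set of products along
    a reduced word depends only on the permutation (Matsumoto's argument with
    the identity x_i(a) x_j(b) x_i(c) =
    x_j(bc/(a+c)) x_i(a+c) x_j(ab/(a+c)) for |i - j| = 1). *)

Require Import Defs.
From HB Require Import structures.
From mathcomp Require Import all_boot all_order all_algebra perm.
From mathcomp Require Import all_classical all_reals topology normedtype matrix_topology matrix_normedtype.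
From mathcomp Require Import zify ring.
Set Implicit Arguments. Unset Strict Implicit. Unset Printing Implicit Defensive.
Import Order.TTheory GRing.Theory Num.Theory.
Import numFieldNormedType.Exports.
Local Open Scope ring_scope.

(** * Inversions and reduced words *)

Lemma mono_ord_ge d n (f : 'I_d -> 'I_n) :
  (forall x y : 'I_d, (x < y)%N -> (f x < f y)%N) -> forall x : 'I_d, (x <= f x)%N.
Proof.
move=> fm [x xn] /=; elim: x xn => // x IH xn.
by apply: (leq_ltn_trans (IH (ltnW xn))); apply: fm.
Qed.

Section Permutations.
Variable n : nat.
Implicit Types (v : 'S_n) (a b : 'I_n).
Local Open Scope nat_scope.

Definition inversions v : {set 'I_n * 'I_n} :=
  [set p : 'I_n * 'I_n | (p.1 < p.2) && (v p.2 < v p.1)].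

(** The inversion number stands in for the minimal length of a word, so that being reduced is a
    counting condition. *)
Definition reduced (w : seq nat) v : Prop :=
  [/\ all (fun i => 0 < i < n) w, (\prod_(i <- w) s_perm n i)%g = v
    & size w = #|inversions v|].

Lemma s_permE a b : b = a.+1 :> nat -> s_perm n b = tperm a b.
Proof.
move=> ab; rewrite /s_perm; have -> : b.-1 = a by rewrite ab.
by rewrite !valK.
Qed.

Lemma s_perm_ends i : 0 < i < n ->
  exists a b, [/\ a = i.-1 :> nat, b = i :> nat & s_perm n i = tperm a b].
Proof.
move=> /andP[i0 il]; have il' : i.-1 < n by lia.
exists (Ordinal il'), (Ordinal il); split=> //.
by rewrite -s_permE //= prednK.
Qed.

Lemma inversions1 : inversions 1 = finset.set0.
Proof. by apply/setP=> -[x y]; rewrite !inE /= !perm1; lia. Qed.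

Lemma card_inversions_w0 : #|inversions (w0 n)| = 'C(n, 2).
Proof.
rewrite -bin2_sum big_mkord.
have -> : inversions (w0 n) = [set p : 'I_n * 'I_n | p.1 < p.2].
  apply/setP=> -[x y]; rewrite !inE /= !permE /=.
  by have := ltn_ord x; have := ltn_ord y; lia.
rewrite -sum1dep_card.
rewrite (eq_bigl (fun p : 'I_n * 'I_n => true && (p.1 < p.2))) //.
rewrite -(pair_big_dep predT (fun x y : 'I_n => x < y) (fun _ _ => 1)) /=.
rewrite (exchange_big_dep predT) //=; apply: eq_bigr => y _.
rewrite -(big_ord_widen n (fun=> 1)) ?(ltnW (ltn_ord y)) //.
by rewrite sum1_card card_ord.
Qed.

(** Exchanging [a] and [b] in both entries of a pair maps the inversions of [v] onto those of the
    product other than [(a, b)], which is the new one. *)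
Lemma card_inversions_ascent v a b : b = a.+1 :> nat -> v a < v b ->
  #|inversions (tperm a b * v)%g| = #|inversions v|.+1.
Proof.
move=> ab vab; set t := tperm a b.
pose T (p : 'I_n * 'I_n) := (t p.1, t p.2).
have TK : involutive T by move=> [x y]; rewrite /T /= /t !tpermK.
have -> : inversions (t * v)%g = (a, b) |: (T @: inversions v).
  apply/setP=> -[x y]; rewrite in_setU1 -[(x, y) in X in _ = _ || X]TK.
  rewrite (mem_imset _ _ (inv_inj TK)) !inE /= !permM -/t xpair_eqE -!val_eqE /t.
  have ne (z c : 'I_n) : z <> c -> z <> c :> nat by move=> h /val_inj.
  case: tpermP => [->|->|/ne xa /ne xb]; case: tpermP => [->|->|/ne ya /ne yb] /=;
    rewrite ?ltnn ?eqxx ?andbF ?orbF //=; lia.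
rewrite cardsU1 (card_imset _ (inv_inj TK)).
rewrite -[(a, b)]TK (mem_imset _ _ (inv_inj TK)) inE /= /t tpermL tpermR.
by have -> : (b < a) = false by lia.
Qed.

Lemma card_inversions_descent v a b : b = a.+1 :> nat -> v b < v a ->
  #|inversions v| = #|inversions (tperm a b * v)%g|.+1.
Proof.
move=> ab vab; rewrite -(card_inversions_ascent ab) ?mulgA ?tperm2 ?mul1g //.
by rewrite !permM tpermL tpermR.
Qed.

Lemma adjacent_perm_neq v a b : b = a.+1 :> nat -> (v a < v b) || (v b < v a).
Proof.
move=> ab; rewrite -neq_ltn; apply/negP=> /eqP /val_inj /perm_inj ab'.
by move: ab; rewrite ab'; lia.
Qed.

Lemma card_inversions_prod w : all (fun i => 0 < i < n) w ->
  #|inversions (\prod_(i <- w) s_perm n i)%g| <= size w.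
Proof.
elim: w => [|i w IH] /=; first by rewrite big_nil inversions1 cards0.
move=> /andP[i0 /IH]; have [a [b [ai bi sE]]] := s_perm_ends i0.
have ab : b = a.+1 :> nat by lia.
rewrite big_cons sE; set v := (\prod_(_ <- _) _)%g.
case/orP: (adjacent_perm_neq v ab) => h.
  by rewrite (card_inversions_ascent ab h).
by rewrite (card_inversions_descent ab h) => /ltnW/leqW.
Qed.

(** The first letter of a reduced word must be a descent: at an ascent the rest of the word would be
    shorter than the inversion number of the permutation it spells. *)
Lemma reduced_cons i w v : reduced (i :: w) v <->
  exists a b, [/\ b = a.+1 :> nat, b = i :> nat, v b < v a &
    reduced w (tperm a b * v)%g].
Proof.
split=> [[/= /andP[i0 wP] vE sz]|[a [b [ab bi vab [wP vE sz]]]]]; last first.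
  split=> /=; first by rewrite -bi ltn_ord ab wP.
    by rewrite big_cons vE -bi (s_permE ab) mulgA tperm2 mul1g.
  by rewrite (card_inversions_descent ab vab) sz.
have [a [b [ai bi sE]]] := s_perm_ends i0.
have ab : b = a.+1 :> nat by lia.
have wE : (\prod_(i <- w) s_perm n i = tperm a b * v)%g.
  by rewrite -vE big_cons sE mulgA tperm2 mul1g.
have := card_inversions_prod wP; rewrite wE => le_w.
case/orP: (adjacent_perm_neq v ab) => h.
  by move: le_w; rewrite (card_inversions_ascent ab h) -sz /= ltnNge leqnSn.
exists a, b; split=> //; split=> //.
by move: sz; rewrite (card_inversions_descent ab h) => -[].
Qed.

Lemma no_descent_mono v : (forall a b, b = a.+1 :> nat -> v a < v b) ->
  forall x y : 'I_n, x < y -> v x < v y.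
Proof.
move=> vP x y; move: {-2}(val y) (erefl (val y)) => m.
elim: m y => [|m IH] y ym; first by rewrite -ym; lia.
move=> xy; have mn : m < n by have := ltn_ord y; rewrite /= in ym *; lia.
have vmy : v (Ordinal mn) < v y by apply: vP; rewrite /= in ym *.
have [xm|xm] := eqVneq x (Ordinal mn); first by rewrite xm.
apply: leq_trans (ltnW vmy); apply: IH => //.
by move: xm; rewrite -val_eqE /= in ym xy *; lia.
Qed.

(** Without descents both [v] and its inverse are increasing, which gives [x <= v x] and [v x <= x]
    for every [x]. *)
Lemma exists_descent v : v != 1%g ->
  exists a b, b = a.+1 :> nat /\ v b < v a.
Proof.
apply: contraNP => noex; apply/eqP/permP => x; rewrite perm1.
have vm : forall x y : 'I_n, x < y -> v x < v y.
  apply: no_descent_mono => a b ab; case/orP: (adjacent_perm_neq v ab) => // h.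
  by case: noex; exists a, b.
have vVm : forall x y : 'I_n, x < y -> (v^-1)%g x < (v^-1)%g y.
  move=> y z yz; rewrite ltnNge; apply/negP; rewrite leq_eqVlt => /orP[/eqP e|h].
    by move: yz; rewrite (perm_inj (val_inj e)) ltnn.
  by have := vm _ _ h; rewrite !permKV; lia.
apply: val_inj; apply/eqP; rewrite eqn_leq (mono_ord_ge vm).
by have := mono_ord_ge vVm (v x); rewrite permK => ->.
Qed.

Lemma reduced_exists v : exists w, reduced w v.
Proof.
move: {-2}#|_| (erefl #|inversions v|) => m.
elim: m v => [|m IH] v vm; have [v1|] := eqVneq v 1%g.
- by exists [::]; split=> //; rewrite ?big_nil // -vm.
- by move=> /exists_descent[a [b [ab /(card_inversions_descent ab)]]]; lia.
- by move: vm; rewrite v1 inversions1 cards0.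
move=> /exists_descent[a [b [ab vab]]].
have [|w wP] := IH (tperm a b * v)%g.
  by move: vm; rewrite (card_inversions_descent ab vab) => -[].
by exists (nat_of_ord b :: w); apply/reduced_cons; exists a, b.
Qed.

Lemma reduced_word_w0_reduced w : reduced_word_w0 n w -> reduced w (w0 n).
Proof. by case=> wP sz wE; split=> //; rewrite card_inversions_w0. Qed.

End Permutations.

(** * Braid moves *)

Section BraidMoves.
Variables (R : realType) (n : nat).
Local Open Scope classical_set_scope.

(** The matrix unit with its 1 in row [k], column [k+1], counted from 1; it is zero for [k] outside
    [1..n-1]. *)
Definition superdiag (k : nat) : 'M[R]_n :=
  \matrix_(i < n, j < n) ((i.+1 == k) && (j == k :> nat))%:R.

Lemma xmatE k (a : R) : xmat n k a = 1%:M + a *: superdiag k.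
Proof.
apply/matrixP => i j; rewrite !mxE eqSS.
by case: ifP => _; rewrite ?mulr1 ?mulr0.
Qed.

Lemma superdiagM k l : l <> k.+1 -> superdiag k *m superdiag l = 0.
Proof.
move=> lk; apply/matrixP => i j; rewrite !mxE big1 // => m _; rewrite !mxE.
by rewrite -natrM mulnb; case: eqP; case: eqP => //=; case: eqP => //=; lia.
Qed.

Lemma xmatM i j (a b : R) : xmat n i a *m xmat n j b =
  1%:M + a *: superdiag i + b *: superdiag j + (a * b) *: (superdiag i *m superdiag j).
Proof.
rewrite !xmatE mulmxDl !mulmxDr !mul1mx mulmx1 -scalemxAl -scalemxAr.
by rewrite scalerA; apply/matrixP => x y; rewrite !mxE; ring.
Qed.

(** Writing [E] for the superdiagonal units, [E_i E_i] and [E_i E_j E_i] vanish, so four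
    coefficients describe the product and the braid identity amounts to comparing them. *)
Lemma xmat_braid i j (a b c : R) : (i = j.+1 \/ j = i.+1) ->
  xmat n i a *m xmat n j b *m xmat n i c =
  1%:M + (a + c) *: superdiag i + b *: superdiag j
  + (a * b) *: (superdiag i *m superdiag j) + (b * c) *: (superdiag j *m superdiag i).
Proof.
move=> ij; rewrite xmatM xmatE mulmxDr mulmx1 -!scalemxAr !mulmxDl mul1mx -!scalemxAl.
rewrite -mulmxA; have -> : superdiag i *m (superdiag j *m superdiag i) = 0.
  case: ij => ij; first by rewrite mulmxA (superdiagM (k := i)) ?mul0mx //; lia.
  by rewrite (superdiagM (k := j)) ?mulmx0 //; lia.
rewrite (superdiagM (k := i) (l := i)); last by lia.
by apply/matrixP => x y; rewrite !mxE; ring.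
Qed.

(** With an arbitrary set [S], a letter becomes an operator on sets, and the braid relations become
    identities that apply at the head of any word. *)
Definition xmat_mul_pos i (S : set 'M[R]_n) : set 'M[R]_n :=
  [set M | exists a u, [/\ 0 < a, S u & M = xmat n i a *m u]].

Lemma Uplus_pos_cons i w :
  @Uplus_pos R n (i :: w) = xmat_mul_pos i (@Uplus_pos R n w).
Proof.
apply/seteqP; split=> u /=.
  move=> [[|a s] [//= [sz] /andP[a0 s0] ->]].
  by exists a, (xprod n w s); split=> //; exists s.
move=> [a [_ [a0 [s [sz s0 ->]] ->]]].
by exists (a :: s); rewrite /= sz a0.
Qed.

Lemma xmat_mul_pos_comm i j S : i <> j -> i <> j.+1 -> j <> i.+1 ->
  xmat_mul_pos i (xmat_mul_pos j S) = xmat_mul_pos j (xmat_mul_pos i S).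
Proof.
move: i j; suff H i j : i <> j -> i <> j.+1 -> j <> i.+1 ->
  xmat_mul_pos i (xmat_mul_pos j S) `<=` xmat_mul_pos j (xmat_mul_pos i S).
  by move=> i j ij ij1 ji1; apply/seteqP; split; apply: H => //; apply: nesym.
move=> ij ij1 ji1 _ [a [_ [a0 [b [u [b0 Su ->]]] ->]]].
exists b, (xmat n i a *m u); split=> //; first by exists a, u.
rewrite !mulmxA !xmatM (superdiagM ij1) (superdiagM ji1).
by congr (_ *m _); apply/matrixP => x y; rewrite !mxE; ring.
Qed.

Lemma xmat_mul_pos_braid i j S : i = j.+1 \/ j = i.+1 ->
  xmat_mul_pos i (xmat_mul_pos j (xmat_mul_pos i S)) =
  xmat_mul_pos j (xmat_mul_pos i (xmat_mul_pos j S)).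
Proof.
move: i j; suff H i j : i = j.+1 \/ j = i.+1 ->
  xmat_mul_pos i (xmat_mul_pos j (xmat_mul_pos i S)) `<=`
  xmat_mul_pos j (xmat_mul_pos i (xmat_mul_pos j S)).
  by move=> i j ij; apply/seteqP; split; apply: H => //; case: ij; [right|left].
move=> ij _ [a [_ [a0 [b [_ [b0 [c [u [c0 Su ->]]] ->]]] ->]]].
have ac0 : 0 < a + c by rewrite addr_gt0.
have acn0 : a + c != 0 by rewrite gt_eqF.
(* The new parameters [p], [q], [r] solve [p + r = b], [q = a + c], [p q = b c] and [q r = a b], by
   comparison of the expanded products. *)
exists (b * c / (a + c)); eexists; split; first by rewrite divr_gt0 ?mulr_gt0.
  exists (a + c); eexists; split=> //.
  exists (a * b / (a + c)), u; split=> //.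
  by rewrite divr_gt0 ?mulr_gt0.
rewrite !mulmxA; congr (_ *m _); rewrite !xmat_braid //; last by case: ij; [right|left].
by apply/matrixP => x y; rewrite !mxE; field.
Qed.

(** Induction on the length. Distinct first letters [i] and [j] are both descents of [v], so [v] has
    reduced words that begin with the two sides of the braid relation for [i] and [j] and share a
    tail [z]. Words with the same first letter are compared through their tails. *)
Lemma Uplus_pos_reduced_eq w w' (v : 'S_n) : reduced w v -> reduced w' v ->
  @Uplus_pos R n w = @Uplus_pos R n w'.
Proof.
move: {2}(size w) (erefl (size w)) => m.
elim/ltn_ind: m w w' v => m IH w w' v wm wv w'v.
have sz' : size w' = size w by case: wv w'v => _ _ -> [].
case: w wm wv sz' => [|i w] wm wv; first by move/size0nil->.
case: w' w'v => // j w' w'v /= [sz'].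
have {}IH (z z' : seq nat) (u : 'S_n) : reduced z u -> reduced z' u -> (size z <= size w)%N ->
    @Uplus_pos R n z = @Uplus_pos R n z'.
  by move=> zu zu' zw; apply: (IH (size z)) zu zu'; rewrite // -wm /= ltnS.
have [ij|ij] := eqVneq i j.
  move: w'v; rewrite -ij !Uplus_pos_cons => /reduced_cons[a' [b' [ab' bi' _ rw']]].
  move/reduced_cons: wv => [a [b [ab bi _ rw]]].
  congr xmat_mul_pos; apply: IH rw _ (leqnn _).
  suff [-> ->] : a = a' /\ b = b' by [].
  by split; apply: val_inj => /=; lia.
wlog lt_ij : i j w w' sz' wm wv w'v IH ij / (i < j)%N => [hw|].
  case: (ltngtP i j) => // h; first exact: hw.
    apply/esym; apply: (hw) => //; first by rewrite /= sz'.
      by move=> z z' u zu zu'; rewrite sz'; apply: IH zu zu'.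
    by rewrite eq_sym.
  by rewrite h eqxx in ij.
move/reduced_cons: (wv) => [a [b [ab bi vab rw]]].
move/reduced_cons: (w'v) => [c [d [cd dj vcd rw']]].
pose s := tperm a b; pose t := tperm c d.
rewrite !Uplus_pos_cons.
have ne (x y : 'I_n) : (x < y)%N -> (x != y) * (y != x).
  by rewrite -!val_eqE /= => xy; rewrite ltn_eqF // gtn_eqF.
have nab : (a != b) * (b != a) by apply: ne; lia.
have ncd : (c != d) * (d != c) by apply: ne; lia.
have nad : (a != d) * (d != a) by apply: ne; lia.
have nbd : (b != d) * (d != b) by apply: ne; lia.
(* Commuting letters: [z] spells [s t v], and [i j z], [j i z] are both reduced words of [v]. *)
have [j1|j1] := eqVneq j i.+1; last first.
  have nac : (a != c) * (c != a) by apply: ne; lia.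
  have nbc : (b != c) * (c != b) by apply: ne; lia.
  have tD (x y z : 'I_n) : (x != z) && (y != z) -> tperm x y z = z.
    by case/andP; exact: tpermD.
  have [z rz] := reduced_exists (s * (t * v))%g.
  have st : (s * t = t * s)%g.
    by rewrite [LHS]conjgC tpermJ !tD ?nac ?nbc ?nad ?nbd.
  have rjz : reduced (j :: z) (s * v)%g.
    apply/reduced_cons; exists c, d; split=> //.
      by rewrite !permM !tD ?nac ?nbc ?nad ?nbd.
    by rewrite mulgA -st -mulgA.
  have riz : reduced (i :: z) (t * v)%g.
    apply/reduced_cons; exists a, b; split=> //.
    by rewrite !permM !tD ?nac ?nbc ?nad ?nbd.
  rewrite (IH _ _ _ rw rjz (leqnn _)) (IH _ _ _ rw' riz) ?sz' //.
  by rewrite !Uplus_pos_cons xmat_mul_pos_comm //; lia.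
(* Neighbouring letters: [z] spells [s t s v], and [i j i z], [j i j z] are both reduced words of
   [v]. *)
have bc : b = c by apply: val_inj => /=; lia.
subst c.
have [z rz] := reduced_exists (s * (t * (s * v)))%g.
have sts : (s * (t * s) = t * (s * t))%g.
  have h (x y : 'I_n) (g : 'S_n) : (tperm x y * (g * tperm x y) = g ^ tperm x y)%g.
    by rewrite conjgE tpermV mulgA.
  by rewrite /s /t !h !tpermJ tpermL tpermR !tpermD ?nad ?nab ?nbd.
have [sa sb] : s a = b /\ s b = a by rewrite tpermL tpermR.
have [tb td] : t b = d /\ t d = b by rewrite tpermL tpermR.
have [ta sd] : t a = a /\ s d = d by rewrite !tpermD ?nad ?nbd ?nab.
have rjiz : reduced (j :: i :: z) (s * v)%g.
  apply/reduced_cons; exists b, d; split=> //.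
    by rewrite !permM sb sd; lia.
  apply/reduced_cons; exists a, b; split=> //.
  by rewrite !permM tb ta sa sd.
have rijz : reduced (i :: j :: z) (t * v)%g.
  apply/reduced_cons; exists a, b; split=> //.
    by rewrite !permM ta tb; lia.
  apply/reduced_cons; exists b, d; split=> //.
    by rewrite !permM sd td sb ta.
  by rewrite -/s -/t; move: rz; rewrite !mulgA in sts *; rewrite sts.
rewrite (IH _ _ _ rw rjiz (leqnn _)) (IH _ _ _ rw' rijz) ?sz' //.
by rewrite !Uplus_pos_cons xmat_mul_pos_braid //; right.
Qed.

End BraidMoves.

(** * Neville elimination *)

(** The letters come in the order in which the elimination produces factors: those that clear the
    first row stand last, after the shifted word of the remaining block. *)
Fixpoint staircase_word n : seq nat :=
  if n is m.+1 then map S (staircase_word m) ++ iota 1 m else [::].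

Section StaircaseWord.

Lemma s_perm_lift n i : (0 < i < n)%N ->
  s_perm n.+1 i.+1 = lift_perm ord0 ord0 (s_perm n i).
Proof.
move=> i0; have [a [b [ai bi ->]]] := s_perm_ends i0.
have -> : i.+1 = lift ord0 b :> nat by rewrite /= /bump bi.
rewrite (@s_permE _ (lift ord0 a)); last by rewrite /= /bump; lia.
apply/permP => x; have [y ->|->] := unliftP ord0 x.
  rewrite lift_perm_lift; have := @lift_inj _ (@ord0 n) => inj.
  case: (tpermP a b) => [->|->|ya yb]; rewrite ?tpermL ?tpermR //.
  by rewrite tpermD // (inj_eq inj) eq_sym; apply/eqP.
by rewrite lift_perm_id tpermD // eq_sym neq_lift.
Qed.

Lemma cycle_permE n m (x : 'I_n.+1) : (m <= n)%N ->
  ((\prod_(i <- iota 1 m) s_perm n.+1 i)%g x : nat) =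
  if x == 0 :> nat then m else if (x <= m)%N then x.-1 else x.
Proof.
elim: m => [|m IH] mn.
  by rewrite big_nil perm1; case: eqP => // x0; case: ifP => //; lia.
have -> : iota 1 m.+1 = iota 1 m ++ [:: m.+1] by rewrite -(addn1 m) iotaD add1n addn1.
rewrite big_cat big_seq1 permM; set y := _ x.
have [a [b [ai bi ->]]] := @s_perm_ends n.+1 m.+1 ltac:(lia).
have {IH} := IH (ltnW mn); rewrite -/y => yE.
have yn := ltn_ord y; have xn := ltn_ord x.
have ne (z c : 'I_n.+1) : z <> c -> z <> c :> nat by move=> h /val_inj.
case: tpermP => [ya|yb|/ne ya /ne yb].
- move: yE; rewrite ya ai /= bi; do ![case: ifP => //]; lia.
- move: yE; rewrite yb ai /= bi; do ![case: ifP => //]; lia.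
- by move: yE ya yb; rewrite ai bi => ->; do ![case: ifP => //]; lia.
Qed.

Lemma reduced_staircase_word n : reduced_word_w0 n (staircase_word n).
Proof.
elim: n => [|n [wP sz wE]]; first by split=> //; apply/permP => -[].
split=> /=.
- rewrite all_cat all_map; apply/andP; split.
    by apply: sub_all wP => i /=; lia.
  by apply/allP => i; rewrite mem_iota; lia.
- by rewrite size_cat size_map size_iota sz binS bin1 addnC.
rewrite big_cat big_map.
have -> : (\prod_(i <- staircase_word n) s_perm n.+1 i.+1 = lift_perm ord0 ord0 (w0 n))%g.
  rewrite -wE; elim: (staircase_word n) wP => [|i w IH] /=.
    by rewrite !big_nil lift_perm1.
  by move=> /andP[i0 /IH wP]; rewrite !big_cons s_perm_lift // wP lift_permM.
(* The shifted [w0 n] fixes 0 and reverses the rest; the cycle then sends 0 to [n] and lowers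
   everything else by one. *)
apply/permP => x; apply: val_inj; rewrite permM [LHS]cycle_permE // [in RHS]permE.
have [y ->|->] := unliftP ord0 x; last by rewrite lift_perm_id /=; lia.
rewrite lift_perm_lift permE /= /bump /=; have := ltn_ord y.
by do ?[case: ifP => //]; lia.
Qed.

End StaircaseWord.

Section NevilleElimination.
Variable R : realType.

(** Columns are given by a map rather than a set: the size [d] is then free, and replacing one
    column, even by a repeated one, still yields a minor. *)
Definition minor n d (h : (d <= n)%N) (f : 'I_d -> 'I_n) (M : 'M[R]_n) : R :=
  \det (\matrix_(i < d, j < d) M (widen_ord h i) (f j)).

Definition col_add n (k l : 'I_n) (a : R) (A : 'M[R]_n) : 'M[R]_n :=
  \matrix_(i, j) (A i j + (if j == l then a * A i k else 0)).

Lemma mulmx_xmat n (k l : 'I_n) a (A : 'M[R]_n) : l = k.+1 :> nat ->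
  A *m xmat n l a = col_add k l a A.
Proof.
move=> lk; rewrite xmatE mulmxDr mulmx1 -scalemxAr.
apply/matrixP => i j; rewrite !mxE; congr (_ + _).
rewrite (bigD1 k) //= big1 ?addr0 => [|m mk]; last first.
  rewrite mxE; have -> : (m.+1 == l) = false.
    by apply/eqP; move: mk; rewrite -val_eqE /=; lia.
  by rewrite mulr0.
rewrite mxE -lk eqxx val_eqE /=.
by case: eqP => _; rewrite ?mulr1 ?mulr0 //; ring.
Qed.

Lemma xprod_cat n w w' (a a' : seq R) : size w = size a ->
  xprod n (w ++ w') (a ++ a') = xprod n w a *m xprod n w' a'.
Proof.
move=> sz; rewrite /xprod zip_cat // foldr_cat.
by elim: (zip w a) => [|p s IH] /=; rewrite ?mul1mx // IH mulmxA.
Qed.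

Lemma det_xprod n w (a : seq R) : all (fun i => 0 < i < n)%N w ->
  \det (xprod n w a) = 1.
Proof.
rewrite /xprod; elim: w a => [|i w IH] [|x a] //=; rewrite ?det1 //.
move=> /andP[i0 wP]; rewrite det_mulmx IH // mulr1.
rewrite -det_tr det_trig; first apply: big1 => j _.
  by rewrite !mxE eqxx; case: ifP; rewrite ?addr0 //; lia.
apply/is_trig_mxP => j k jk; rewrite !mxE.
rewrite -val_eqE gtn_eqF //=; case: ifP; rewrite ?addr0 //; lia.
Qed.

Lemma xprod_lift n w (a : seq R) : all (fun i => 0 < i < n)%N w ->
  xprod n.+1 (map S w) a = block_mx 1%:M 0 0 (xprod n w a) :> 'M_(1 + n).
Proof.
rewrite /xprod; elim: w a => [|i w IH] [|x a] //=; rewrite -?scalar_mx_block //.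
move=> /andP[i0 wP]; rewrite IH //.
have -> : xmat n.+1 i.+1 x = block_mx 1%:M 0 0 (xmat n i x) :> 'M_(1 + n).
  apply/matrixP => j k; rewrite mxE -(fintype.splitK j) -(fintype.splitK k).
  case: (fintype.split j) => j' /=; case: (fintype.split k) => k' /=.
  - rewrite block_mxEul !mxE -!val_eqE !ord1 /=.
    by case: ifP; rewrite ?addr0 //; lia.
  - rewrite block_mxEur !mxE -!val_eqE !ord1 /=.
    by case: ifP; rewrite ?addr0 //; lia.
  - rewrite block_mxEdl !mxE -!val_eqE !ord1 /=.
    by case: ifP; rewrite ?addr0 //; lia.
  - by rewrite block_mxEdr !mxE -!val_eqE /= !add1n !eqSS.
by rewrite (@mulmx_block _ 1 n 1 n 1 n) !mulmx0 !mul0mx !mul1mx !addr0 add0r.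
Qed.

Definition neville_coef n (A : 'M[R]_n.+1) (j : nat) : R :=
  A 0 (inord j) / A 0 (inord j.-1).

(* Clears row 0 of column j by means of column j-1, keeping column 0. *)
Definition neville n (A : 'M[R]_n.+1) : 'M[R]_n.+1 :=
  \matrix_(i, j) (A i j -
    (if j == 0 then 0 else neville_coef A j * A i (inord j.-1))).

Lemma neville_xprod n (A : 'M[R]_n.+1) :
  neville A *m xprod n.+1 (iota 1 n) (map (neville_coef A) (iota 1 n)) = A.
Proof.
(* The factors restore [A] from left to right: in [T m] the columns up to [m] are already those of
   [A], so the next factor adds back the multiple of the true column [m] that was subtracted from
   column [m+1]. *)
pose T m : 'M[R]_n.+1 := \matrix_(i, j) (if (j <= m)%N then A i j else neville A i j).
have T0 : neville A = T 0%N.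
  apply/matrixP => i j; rewrite !mxE leqn0 -val_eqE /=.
  by case: eqP => //; rewrite subr0.
have Tn : T n = A.
  by apply/matrixP => i j; rewrite !mxE -ltnS ltn_ord.
suff H p k : (k + p <= n)%N ->
    T k *m xprod n.+1 (iota k.+1 p) (map (neville_coef A) (iota k.+1 p)) = T (k + p)%N.
  by rewrite T0 H ?add0n // Tn.
elim: p k => [|p IH] k kp; first by rewrite /xprod /= mulmx1 addn0.
rewrite /xprod /= mulmxA -addSnnS -IH; last by lia.
congr (_ *m _).
have kn : (k.+1 < n.+1)%N by lia.
rewrite (@mulmx_xmat _ (inord k) (Ordinal kn)); last by rewrite inordK //; lia.
have eqE m (mn : (m < n.+1)%N) (z : 'I_n.+1) : (z == Ordinal mn) = (z == m :> nat) by [].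
apply/matrixP => i j; rewrite !mxE !eqE /=.
case: (ltngtP j k.+1) => jk /=.
- by rewrite -ltnS jk addr0.
- by rewrite leqNgt (ltn_trans _ jk) // addr0.
- rewrite jk ltnn inordK ?leqnn /=; last by lia.
  by ring.
Qed.

Lemma neville_row0 n (A : 'M[R]_n.+1) j : (forall j, A 0 j != 0) -> j != 0 ->
  neville A 0 j = 0.
Proof.
move=> A0 j0; rewrite !mxE (negbTE j0) /neville_coef divfK //.
by rewrite inord_val subrr.
Qed.

Lemma neville_col0 n (A : 'M[R]_n.+1) i : neville A i 0 = A i 0.
Proof. by rewrite !mxE eqxx subr0. Qed.

Definition neville_step n (A : 'M[R]_n.+1) : 'M[R]_n :=
  @drsubmx _ 1 n 1 n (neville A).

Lemma neville_block n (A : 'M[R]_n.+1) : (forall j, A 0 j != 0) ->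
  neville A = block_mx (A 0 0)%:M 0 (@dlsubmx _ 1 n 1 n (neville A)) (neville_step A)
    :> 'M_(1 + n).
Proof.
move=> A0; rewrite -[LHS](@submxK _ 1 n 1 n); congr block_mx.
  by rewrite [LHS]mx11_scalar mxE lshift0 mxE lshift0 neville_col0.
apply/matrixP => i j; rewrite ord1 mxE mxE lshift0 neville_row0 ?mxE //.
Qed.

Lemma det_neville_step n (A : 'M[R]_n.+1) : (forall j, A 0 j != 0) ->
  \det A = A 0 0 * \det (neville_step A).
Proof.
move=> A0; rewrite -{1}(neville_xprod A) det_mulmx det_xprod ?mulr1; last first.
  by apply/allP => i; rewrite mem_iota; lia.
by rewrite neville_block // (@det_lblock _ 1 n) det_scalar1.
Qed.

Lemma is_trig_mulmx n (A B : 'M[R]_n) :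
  is_trig_mx A -> is_trig_mx B -> is_trig_mx (A *m B).
Proof.
move=> /is_trig_mxP A0 /is_trig_mxP B0; apply/is_trig_mxP => i j ij.
rewrite mxE big1 // => k _; case: (ltnP i k) => ik; first by rewrite A0 ?mul0r.
by rewrite B0 ?mulr0 // (leq_ltn_trans ik).
Qed.

Definition interval_minors_pos n (M : 'M[R]_n) : Prop :=
  forall d (h : (d <= n)%N) (f : 'I_d -> 'I_n) j,
    (forall l : 'I_d, f l = (j + l)%N :> nat) -> 0 < minor h f M.

Lemma interval_minors_pos_row0 n (M : 'M[R]_n.+1) : interval_minors_pos M ->
  forall j, 0 < M 0 j.
Proof.
move=> MP j; have := MP 1%N isT (fun=> j) j.
rewrite /minor det_mx11 mxE (_ : widen_ord _ _ = 0); last exact: val_inj.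
by apply => l; rewrite ord1 addn0.
Qed.

(* Each interval minor of the Neville step is, up to a positive entry of the
   first row, the interval minor of [M] with one more row and one more column
   on the left. *)
Lemma interval_minors_pos_neville_step n (M : 'M[R]_n.+1) :
  interval_minors_pos M -> interval_minors_pos (neville_step M).
Proof.
move=> MP d h f j fj; have M0 := interval_minors_pos_row0 MP.
case: d => [|d] in h f fj *; first by rewrite /minor det_mx00.
have jd : (j + d < n)%N by have := ltn_ord (f ord_max); rewrite fj.
pose g (l : 'I_d.+2) : 'I_n.+1 := inord (j + l).
have gE (l : 'I_d.+2) : g l = (j + l)%N :> nat.
  by rewrite inordK //; have := ltn_ord l; lia.
have h' : (d.+2 <= n.+1)%N by [].
have := MP _ h' g j gE; rewrite /minor; set A := \matrix_(_, _) _.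
have A0 l : A 0 l = M 0 (g l).
  by rewrite mxE; congr (M _ _); apply: val_inj.
rewrite det_neville_step => [|l]; last by rewrite A0 gt_eqF.
(* Elimination uses only the left neighbour of a column, so it commutes with restriction to
   consecutive columns. *)
rewrite A0 pmulr_rgt0 //; congr (0 < \det _).
apply/matrixP => i l; rewrite !mxE /neville_coef !A0.
have -> : widen_ord h' (rshift 1 i) = rshift 1 (widen_ord h i) by exact: val_inj.
have gl : g (rshift 1 l) = rshift 1 (f l).
  by apply: val_inj; rewrite [LHS]gE /= fj; lia.
have gl' : g (inord (rshift 1 l).-1) = inord (rshift 1 (f l)).-1.
  have := ltn_ord l; have := ltn_ord (f l); rewrite fj => flt llt.
  by apply: val_inj; rewrite [LHS]gE /= !inordK ?fj //; lia.
have inordE : inord (rshift 1 l) = rshift 1 l :> 'I_d.+2 by rewrite inord_val.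
have inordE' : inord (rshift 1 (f l)) = rshift 1 (f l) :> 'I_n.+1 by rewrite inord_val.
by rewrite inordE inordE' gl gl'.
Qed.

Theorem neville_factorization n (M : 'M[R]_n) : interval_minors_pos M ->
  exists L, [/\ is_trig_mx L, L \in unitmx & Uplus_pos (staircase_word n) (L *m M)].
Proof.
elim: n M => [|n IH] M MP.
  exists 1%:M; rewrite scalar_mx_is_trig unitmx1; split=> //.
  by exists [::]; split=> //; apply/matrixP => -[].
have M0 := interval_minors_pos_row0 MP.
have Mn0 j : M 0 j != 0 by rewrite gt_eqF.
have [L [Ltrig Lunit [a [sz a0 LM]]]] := IH _ (interval_minors_pos_neville_step MP).
(* [L0] scales the corner of [neville M] to 1 and clears the column below it; [L1] then applies the
   recursive [L] to the remaining block. *)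
pose L0 : 'M[R]_(1 + n) := block_mx (M 0 0)^-1%:M 0
  (- (M 0 0)^-1 *: @dlsubmx _ 1 n 1 n (neville M)) 1%:M.
have L0unit : L0 \in unitmx.
  by rewrite unitmxE det_lblock det_scalar1 det1 mulr1 unitrV unitfE.
have L0trig : is_trig_mx L0.
  by rewrite is_trig_block_mx // eqxx !scalar_mx_is_trig.
pose L1 : 'M[R]_(1 + n) := block_mx 1%:M 0 0 L.
have L1unit : L1 \in unitmx.
  by rewrite unitmxE det_lblock det1 mul1r -unitmxE.
have L1trig : is_trig_mx L1.
  by rewrite is_trig_block_mx // eqxx scalar_mx_is_trig.
have [wP _ _] := reduced_staircase_word n.
exists (L1 *m L0); split; first exact: is_trig_mulmx.
  by rewrite unitmx_mul L1unit.
exists (a ++ map (neville_coef M) (iota 1 n)); split.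
- by rewrite /= !size_cat !size_map size_iota sz.
(* The new parameters are quotients of entries of the first row. *)
- rewrite all_cat a0 all_map; apply/allP => j _ /=.
  by rewrite divr_gt0.
rewrite /= xprod_cat ?size_map ?sz // xprod_lift // -LM -[in LHS](neville_xprod M).
rewrite !mulmxA; congr (_ *m _).
rewrite neville_block // -mulmxA.
rewrite (@mulmx_block _ 1 n 1 n 1 n) (@mulmx_block _ 1 n 1 n 1 n).
rewrite ?(mulmx0, mul0mx, mul1mx, mulmx1, addr0, add0r).
by rewrite -scalar_mxM mulVf // mul_mx_scalar scalerA mulrN mulfV // scaleN1r addNr mulmx0.
Qed.

End NevilleElimination.

(** * Pluecker coordinates *)

Section Subsets.
Local Open Scope nat_scope.

Lemma card_initial_segment n d : d <= n -> #|[set x : 'I_n | x < d]%SET| = d.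
Proof.
move=> dn; rewrite -sum1dep_card -(big_ord_widen n (fun=> 1)) //.
by rewrite sum1_card card_ord.
Qed.

Lemma enum_val_mono n (I : {set 'I_n}) (x y : 'I_#|I|) :
  x < y -> enum_val x < enum_val y.
Proof.
move=> xy; have i0 := enum_val x; rewrite !(enum_val_nth i0).
have srt : sorted (fun i j : 'I_n => i < j) (enum I).
  rewrite {1}/enum_mem; apply: sorted_filter; first by move=> ? ? ?; apply: ltn_trans.
  by have := iota_ltn_sorted 0 n; rewrite -val_enum_ord sorted_map enumT.
apply: (sorted_ltn_nth _ i0 srt) => //; first by move=> ? ? ?; apply: ltn_trans.
- by rewrite inE -cardE.
- by rewrite inE -cardE.
Qed.

Lemma mono_ord_inj d n (f : 'I_d -> 'I_n) :
  (forall x y : 'I_d, x < y -> f x < f y) -> injective f.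
Proof.
move=> fm x y fxy; apply: val_inj; case: (ltngtP x y) => // h.
  by have := fm _ _ h; rewrite fxy ltnn.
by have := fm _ _ h; rewrite fxy ltnn.
Qed.

Lemma mono_ord_image_inj d n (f g : 'I_d -> 'I_n) :
  (forall x y : 'I_d, x < y -> f x < f y) ->
  (forall x y : 'I_d, x < y -> g x < g y) ->
  (f @: 'I_d = g @: 'I_d)%SET -> f =1 g.
Proof.
move=> fm gm fg.
have srt (h : 'I_d -> 'I_n) : (forall x y : 'I_d, x < y -> h x < h y) ->
    sorted (fun i j : 'I_n => i < j) (map h (enum 'I_d)).
  move=> hm; apply: (homo_sorted (e := fun i j : 'I_d => i < j)) => //.
  by have := iota_ltn_sorted 0 d; rewrite -val_enum_ord sorted_map.
have E : map f (enum 'I_d) = map g (enum 'I_d).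
  apply: (irr_sorted_eq (leT := fun i j : 'I_n => i < j)) (srt _ fm) (srt _ gm) _.
  - by move=> ? ? ?; apply: ltn_trans.
  - by move=> ?; rewrite ltnn.
  move=> y; move/setP/(_ y): fg => fgy.
  have H (h : 'I_d -> 'I_n) : (y \in map h (enum 'I_d)) = (y \in (h @: 'I_d)%SET).
    apply/mapP/imsetP => -[x _ ->]; exists x => //; exact: mem_enum.
  by rewrite !H.
by move=> x; apply: (iffRL (eq_in_map f g (enum 'I_d)) E); rewrite mem_enum.
Qed.

(** An element [x] of [I] brings all of [0..x] into [I], hence [x < #|I|]; an inclusion between sets
    of equal size is an equality. *)
Lemma down_closed_initial_segment n (I : {set 'I_n}) :
  (forall k l : 'I_n, l = k.+1 :> nat -> l \in I -> k \in I) ->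
  [set x : 'I_n | x < #|I|]%SET = I.
Proof.
move=> down; apply/esym/eqP.
rewrite eqEcard card_initial_segment ?card_set_ord_le // leqnn andbT.
apply/fintype.subsetP => x xI; rewrite inE -{1}(card_initial_segment (ltn_ord x)).
apply: subset_leq_card; apply/fintype.subsetP => y; rewrite inE ltnS => /subnKC.
move: (x - y) => t; elim: t y => [|t IHt] y xE.
  by rewrite (_ : y = x) //; apply: val_inj; rewrite /= -xE addn0.
have yn : y.+1 < n by have := ltn_ord x; lia.
by apply: (down y (Ordinal yn)) => //; apply: IHt; rewrite /= -xE addSnnS.
Qed.

(* Moving an element down by one step connects every subset to the initial
   segment of its cardinality. *)
Lemma adjacent_move_ind n (S : {set 'I_n} -> Prop) :
  (forall (I : {set 'I_n}) (k l : 'I_n), l = k.+1 :> nat -> k \notin I -> l \in I ->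
     S (tperm k l @: I)%SET <-> S I) ->
  forall I J : {set 'I_n}, #|I| = #|J| -> S I -> S J.
Proof.
move=> Smove.
suff H (I : {set 'I_n}) : S I <-> S [set x : 'I_n | x < #|I|]%SET.
  by move=> I J IJ /(H I) SI; apply/(H J); rewrite -IJ.
(* The measure is the sum of the elements, which a move from [l] down to [k] lowers by one. *)
have [m Im] : exists m, m = \sum_(x in I) (x : nat) by eexists.
elim/ltn_ind: m => m IH in I Im *.
have [/existsP[k /existsP[l /and3P[/eqP lk kI lI]]]|down] := boolP
  [exists k : 'I_n, [exists l : 'I_n, [&& l == k.+1 :> nat, k \notin I & l \in I]]].
  have cardI : #|(tperm k l @: I)%SET| = #|I| by rewrite card_imset //; exact: perm_inj.
  rewrite -(Smove _ _ _ lk kI lI); have := IH _ _ (tperm k l @: I)%SET erefl.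
  rewrite cardI; apply.
  rewrite big_imset /=; last by move=> ? ? _ _; apply: perm_inj.
  rewrite Im (bigD1 l) //= [ltnRHS](bigD1 l) //= tpermR lk.
  rewrite (eq_bigr (fun x : 'I_n => x : nat)) ?addSn //.
  move=> x /andP[xI xl]; rewrite tpermD // 1?eq_sym //.
  by apply: contraNneq kI => <-.
rewrite down_closed_initial_segment // => k l lk lI.
apply: contraNT down => kI; apply/existsP; exists k; apply/existsP; exists l.
by rewrite lk eqxx kI.
Qed.

End Subsets.

(** * Minors under row and column operations *)

Section Pluecker.
Variables (R : realType) (n : nat).
Implicit Types M : 'M[R]_n.

Lemma pluckerE M (I : {set 'I_n}) :
  plucker M I = minor (card_set_ord_le I) (@enum_val _ (mem I)) M.
Proof. by []. Qed.

Lemma enum_val_image (I : {set 'I_n}) :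
  ((@enum_val _ (mem I)) @: 'I_#|I|)%SET = I.
Proof.
apply/setP => x; apply/imsetP/idP => [[i _ ->]|xI]; first exact: enum_valP.
by exists (enum_rank_in xI x) => //; rewrite enum_rankK_in.
Qed.

Lemma minor_plucker d (h : (d <= n)%N) (f : 'I_d -> 'I_n) M :
  (forall x y : 'I_d, (x < y)%N -> (f x < f y)%N) ->
  minor h f M = plucker M (f @: 'I_d)%SET.
Proof.
move=> fm; rewrite pluckerE; set I := imset _ _.
have : (@enum_val _ (mem I)) @: 'I_#|I| = I by exact: enum_val_image.
have : forall x y : 'I_#|I|, (x < y)%N -> (enum_val x < enum_val y)%N.
  by move=> x y; exact: enum_val_mono.
have : #|I| = d by rewrite card_imset ?card_ord //; exact: mono_ord_inj.
(* The size [#|I|] equals [d] only propositionally, so it is generalized together with the bound and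
   the enumeration that depend on it. *)
move: (card_set_ord_le I) (@enum_val _ (mem I)); move: #|I| => d' h' g dd'.
subst d' => gm gf; have gE := mono_ord_image_inj gm fm gf.
rewrite /minor; congr (\det _); apply/matrixP => i j; rewrite !mxE gE.
by congr (M _ _); apply: val_inj.
Qed.

(** The first [d] rows of [L *m M] involve only the first [d] rows of [M], so the submatrix is the
    leading block of [L] times that of [M]. *)
Lemma minor_trig_mulmx d (h : (d <= n)%N) (f : 'I_d -> 'I_n) (L M : 'M[R]_n) :
  is_trig_mx L ->
  minor h f (L *m M) = (\prod_(i < d) L (widen_ord h i) (widen_ord h i)) * minor h f M.
Proof.
move=> /is_trig_mxP L0; rewrite /minor.
pose Ld := \matrix_(i < d, j < d) L (widen_ord h i) (widen_ord h j).
have -> : \prod_(i < d) L (widen_ord h i) (widen_ord h i) = \det Ld.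
  rewrite det_trig; first by apply: eq_bigr => i _; rewrite mxE.
  by apply/is_trig_mxP => i j ij; rewrite mxE L0.
rewrite -det_mulmx; congr (\det _); apply/matrixP => i j; rewrite !mxE.
rewrite (bigID (fun k : 'I_n => (k < d)%N)) /= [X in _ + X]big1 ?addr0; last first.
  by move=> k kd; rewrite L0 ?mul0r //=; have := ltn_ord i; lia.
(* The summand is extended by 0 to all naturals, to pass from a sum over ['I_n] to one over
   ['I_d]. *)
pose F (k : nat) := if insub k is Some k' then L (widen_ord h i) k' * M k' (f j) else 0.
transitivity (\sum_(k < n | (k < d)%N) F k).
  by apply: eq_bigr => k _; rewrite /F valK.
rewrite -(big_ord_widen n F) //; apply: eq_bigr => k _; rewrite !mxE /F.
have -> : k = widen_ord h k :> nat by [].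
by rewrite valK.
Qed.

Lemma minor_col_add d (h : (d <= n)%N) (f : 'I_d -> 'I_n) (k l : 'I_n) a M j0 :
  injective f -> f j0 = l ->
  minor h f (col_add k l a M) =
  minor h f M + a * minor h (fun j => if j == j0 then k else f j) M.
Proof.
move=> finj fj0; rewrite /minor -!(det_tr (\matrix_(_, _) _)).
rewrite -[X in _ = X + _]mul1r; apply: (determinant_multilinear (i0 := j0)).
- by apply/rowP => i; rewrite !mxE !eqxx fj0 eqxx mul1r.
- apply/matrixP => j i; rewrite !mxE -fj0 (inj_eq finj) eq_sym.
  by rewrite (negbTE (neq_lift _ _)) addr0.
- apply/matrixP => j i; rewrite !mxE -fj0 (inj_eq finj) ![lift _ _ == _]eq_sym.
  by rewrite (negbTE (neq_lift _ _)) addr0.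
Qed.

(** Multilinearity produces the minor with column [l] replaced by column [k]. It has two equal
    columns if [k] is in [I]; otherwise, [k] and [l] being adjacent, the columns stay in increasing
    order and no sign appears. *)
Lemma plucker_col_add (I : {set 'I_n}) (k l : 'I_n) a M :
  (l = k.+1 :> nat) \/ (k = l.+1 :> nat) ->
  plucker (col_add k l a M) I = plucker M I +
    (if (k \notin I) && (l \in I) then a * plucker M (tperm k l @: I)%SET else 0).
Proof.
move=> kl; rewrite [LHS]pluckerE [plucker M I]pluckerE; set h := card_set_ord_le I.
set f := @enum_val _ (mem I).
have fm (x y : 'I_#|I|) : (x < y)%N -> (f x < f y)%N by exact: enum_val_mono.
have finj := mono_ord_inj fm.
have fI x : f x \in I by exact: enum_valP.
have [lI|lI] := boolP (l \in I); last first.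
  rewrite andbF addr0 /minor; congr (\det _); apply/matrixP => i j; rewrite !mxE.
  by case: eqP => [fl|_]; [rewrite -fl fI in lI | rewrite addr0].
have fsurj z : z \in I -> exists j, f j = z.
  by rewrite -{1}(enum_val_image I) => /imsetP[j _ ->]; exists j.
have [j0 fj0] := fsurj _ lI.
rewrite (minor_col_add _ _ _ _ finj fj0); congr (_ + _).
have [kI|kI] /= := boolP (k \in I).
  have [j1 fj1] := fsurj _ kI.
  rewrite /minor -det_tr (determinant_alternate (i1 := j0) (i2 := j1)) ?mulr0 //.
    by apply/eqP => j01; move: kl; rewrite -fj1 -j01 fj0; lia.
  by move=> i; rewrite !mxE eqxx; case: eqP => // _; rewrite fj1.
congr (_ * _); pose g j := if j == j0 then k else f j.
have gE x : g x = tperm k l (f x).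
  rewrite /g; case: eqP => [->|xj0]; first by rewrite fj0 tpermR.
  rewrite tpermD //; first by apply: contraNneq kI => ->.
  by rewrite -fj0 (inj_eq finj) eq_sym; apply/eqP.
rewrite (_ : (tperm k l @: I)%SET = (g @: 'I_#|I|)%SET); last first.
  rewrite -{1}(enum_val_image I) -imset_comp.
  by apply: eq_imset => x; rewrite /= gE.
rewrite -minor_plucker // => x y /fm xy; rewrite !gE.
have ne z c : c \notin I -> f z <> c :> nat.
  by move=> /negP cI /val_inj fz; apply: cI; rewrite -fz.
have ne' (z c : 'I_n) : z <> c -> z <> c :> nat by move=> zc /val_inj.
move: xy (ne x k kI) (ne y k kI).
by case: tpermP => [->|->|/ne' xk /ne' xl]; case: tpermP => [->|->|/ne' yk /ne' yl]; lia.
Qed.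

(** If all minors of size [d] on the first rows vanished, expansion along the last row would
    propagate this to every larger size, up to the determinant of [M]. *)
Lemma plucker_neq0 M d : M \in unitmx -> (d <= n)%N ->
  exists I : {set 'I_n}, #|I| = d /\ plucker M I != 0.
Proof.
move=> Mu dn; apply: contrapT => noI.
have zero d' (h : (d <= d' <= n)%N) (h' : (d' <= n)%N) (f : 'I_d' -> 'I_n) :
    (forall x y : 'I_d', (x < y)%N -> (f x < f y)%N) -> minor h' f M = 0.
  elim: d' => [|d' IH] in h h' f * => fm.
    rewrite minor_plucker //; apply: contrapT => /eqP nz; apply: noI.
    exists (f @: 'I_0)%SET; split=> //; rewrite card_imset ?card_ord; last exact: mono_ord_inj.
    by lia.
  have [dd'|dd'] := eqVneq d d'.+1.
    rewrite minor_plucker //; apply: contrapT => /eqP nz; apply: noI.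
    by exists (f @: 'I_d'.+1)%SET; split=> //; rewrite card_imset ?card_ord //; exact: mono_ord_inj.
  have h1 : (d <= d' <= n)%N by lia.
  have h2 : (d' <= n)%N by lia.
  rewrite /minor (expand_det_row _ ord_max) big1 // => j _; rewrite mxE /cofactor.
  have := IH h1 h2 (f \o lift j); rewrite /minor => IH'.
  set B := row' _ _; rewrite (_ : B = \matrix_(i, l) M (widen_ord h2 i) ((f \o lift j) l)).
    rewrite IH' ?mulr0 // => x y xy; apply: fm.
    by rewrite /= /bump; lia.
  apply/matrixP => x y; rewrite !mxE; congr (M _ _); apply: val_inj => /=.
  by rewrite /bump leqNgt ltn_ord.
have : minor (leqnn n) id M = 0 by apply: zero; rewrite ?dn ?leqnn.
rewrite /minor (_ : \matrix_(_, _) _ = M).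
  by move/eqP; apply/negP; rewrite -unitfE -unitmxE.
by apply/matrixP => i j; rewrite !mxE; congr (M _ _); apply: val_inj.
Qed.

(** An increasing [f] satisfies [i <= f i], so the submatrix is lower triangular with diagonal
    entries 0 or 1. *)
Lemma plucker1_ge0 (I : {set 'I_n}) : 0 <= plucker (1%:M : 'M[R]_n) I.
Proof.
rewrite pluckerE; have := @enum_val_mono _ I; move: (enum_val (A := _)) => f fm.
rewrite /minor det_trig; first by apply: prodr_ge0 => i _; rewrite !mxE ler0n.
apply/is_trig_mxP => i j ij; rewrite !mxE -val_eqE ltn_eqF //=.
by apply: leq_trans ij _; exact: mono_ord_ge.
Qed.

Lemma plucker_Uplus_ge0 w u (I : {set 'I_n}) : all (fun i => 0 < i < n)%N w ->
  Uplus_pos w u -> 0 <= plucker (u : 'M[R]_n) I.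
Proof.
move=> wP [a [sz a0 ->]].
(* Factors act on the right, so the induction along the word runs over an arbitrary left factor
   [A]. *)
suff H A : (forall I, 0 <= plucker A I) -> forall I, 0 <= plucker (A *m xprod n w a) I.
  by rewrite -(mul1mx (xprod _ _ _)); apply: H; exact: plucker1_ge0.
elim: w a wP sz a0 A {I} => [|i w IH] [|x a] //=; first by rewrite /xprod /= => *; rewrite mulmx1.
move=> /andP[i0 wP] [sz] /andP[x0 a0] A A0; rewrite /xprod /= mulmxA.
apply: IH => // I; have [k [l [ki li _]]] := s_perm_ends i0.
have lk : l = k.+1 :> nat by lia.
rewrite -li (mulmx_xmat _ _ lk) plucker_col_add; last by left.
by rewrite addr_ge0 //; case: ifP => // _; rewrite mulr_ge0 // ltW.
Qed.

End Pluecker.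

(** * Topology of the flag variety *)

Section Flags.
Variables (R : realType) (n : nat).
Local Open Scope classical_set_scope.
Implicit Types M N : 'M[R]_n.

Lemma det_continuous (T : topologicalType) d (F : T -> 'M[R]_d) :
  (forall i j, continuous (fun x => F x i j)) -> continuous (fun x => \det (F x)).
Proof.
move=> Fc; rewrite /determinant; apply: continuous_big => [|s _]; first exact: add_continuous.
move=> x; apply: cvgM; first exact: cvg_cst.
by apply: continuous_big => [|i _]; [exact: mul_continuous | exact: Fc].
Qed.

Lemma plucker_continuous (I : {set 'I_n}) : continuous (fun M => plucker M I).
Proof.
apply: det_continuous => i j.
under eq_fun do rewrite mxE.
exact: coord_continuous.
Qed.

Lemma plucker_trig_mulmx (L M : 'M[R]_n) (I : {set 'I_n}) : is_trig_mx L ->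
  plucker (L *m M) I = (\prod_(i < n | (i < #|I|)%N) L i i) * plucker M I.
Proof.
by move=> Lt; rewrite (big_ord_narrow (card_set_ord_le I)) !pluckerE minor_trig_mulmx.
Qed.

(** For sets of equal size, a change of representative multiplies [P_I P_J] by a nonzero square, so
    its sign belongs to the flag. The squared determinant keeps singular matrices out. *)
Lemma flag_open_plucker_lt0 (I J : {set 'I_n}) : #|I| = #|J| ->
  flag_open [set M : 'M[R]_n | (\det M) ^+ 2 * (plucker M I * plucker M J) < 0].
Proof.
move=> IJ; split.
- pose f (M : 'M[R]_n) := (\det M) ^+ 2 * (plucker M I * plucker M J).
  apply: (@open_comp _ _ f [set x | x < 0]); last exact: open_lt.
  move=> M _.
  have dc : {for M, continuous (fun M : 'M[R]_n => \det M)}.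
    by apply: det_continuous => i j; exact: coord_continuous.
  have pc K : {for M, continuous (fun M : 'M[R]_n => plucker M K)} by exact: plucker_continuous.
  exact: (continuousM (continuousM dc dc) (continuousM (pc I) (pc J))).
- move=> M /=; rewrite unitmxE unitfE; apply: contraTneq => ->.
  by rewrite expr0n mul0r ltxx.
move=> A B [L [Lt Lu ->]] /=; rewrite !plucker_trig_mulmx // -IJ det_mulmx.
set c := \prod_(_ < _ | _) _.
have c0 : c != 0.
  move: Lu; rewrite unitmxE unitfE det_trig // => /prodf_neq0 h.
  by apply/prodf_neq0 => i _; exact: h.
have d0 : \det L != 0 by rewrite -unitfE -unitmxE.
have -> : (\det L * \det A) ^+ 2 * (c * plucker A I * (c * plucker A J)) =
  (\det L * c) ^+ 2 * (\det A ^+ 2 * (plucker A I * plucker A J)) by ring.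
by move=> h; rewrite pmulr_rlt0 // exprn_even_gt0 //= mulf_neq0.
Qed.

(** The coordinates of each degree [d] share a sign [e d], which a diagonal change of representative
    can correct in all degrees at once. *)
Lemma nonneg_plucker_of_mul_ge0 M :
  (forall I J : {set 'I_n}, #|I| = #|J| -> 0 <= plucker M I * plucker M J) ->
  nonneg_plucker M.
Proof.
move=> MP.
pose e d : R := (-1) ^+ `[< exists I : {set 'I_n}, #|I| = d /\ plucker M I < 0 >].
have eP d : e d * e d = 1 by rewrite /e -signr_addb addbb.
have eM (I : {set 'I_n}) : 0 <= e #|I| * plucker M I.
  rewrite /e; case: asboolP => [[J [JI MJ]]|noJ].
    by rewrite mulN1r oppr_ge0 -(nmulr_lge0 _ MJ); apply: MP.
  by rewrite mul1r leNgt; apply/negP => h; apply: noJ; exists I.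
have e0 : e 0%N = 1.
  rewrite /e; case: asboolP => // -[I [I0]].
  have -> : plucker M I = 1.
    by rewrite pluckerE; move: (card_set_ord_le I) (enum_val (A := _)); rewrite I0 => h f; exact: det_mx00.
  by rewrite ltr10.
(* The product of the first [d] diagonal entries telescopes to [e d], because [e 0 = 1]. *)
pose D : 'M[R]_n := diag_mx (\row_i (e i.+1 * e i)).
have Dt : is_trig_mx D by exact: diag_mx_is_trig.
exists (D *m M); split.
  exists D; split=> //; rewrite unitmxE unitfE det_diag.
  apply/prodf_neq0 => i _; rewrite mxE /= mulf_neq0 //; apply/eqP => h.
    by have /eqP := eP i.+1; rewrite h mul0r eq_sym oner_eq0.
  by have /eqP := eP i; rewrite h mul0r eq_sym oner_eq0.
move=> I; rewrite pluckerE minor_trig_mulmx // -pluckerE.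
suff -> : \prod_(i < #|I|) D (widen_ord (card_set_ord_le I) i) (widen_ord (card_set_ord_le I) i) = e #|I|.
  exact: eM.
under eq_bigr do rewrite !mxE eqxx mulr1n /=.
elim: #|I| => [|d IH]; first by rewrite big_ord0 e0.
by rewrite big_ord_recr /= IH mulrCA eP mulr1.
Qed.

Lemma open_col_add (U : set 'M[R]_n) (k l : 'I_n) M : open U -> U M ->
  exists a, 0 < a /\ U (col_add k l a M).
Proof.
rewrite openE => /(_ M) /[apply] /nbhs_ballP[e /= e0 eU].
(* [C] strictly exceeds every entry of column [k] in absolute value, so adding [e / C] times that
   column moves each entry by less than [e]. *)
pose C := 1 + \sum_i `|M i k|.
have C0 : 0 < C by rewrite ltr_pwDl // sumr_ge0.
exists (e / C); split; first by rewrite divr_gt0.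
apply: eU; split=> // i j; rewrite mxE /ball /= opprD addNKr normrN.
case: ifP => _; last by rewrite normr0.
rewrite normrM gtr0_norm ?divr_gt0 // mulrAC ltr_pdivrMr // ltr_pM2l //.
rewrite /C (bigD1 i) //= ltr_pwDl // lerDl sumr_ge0 //.
Qed.

(** Induction on the number of vanishing coordinates: a small column addition makes one of them
    positive and, all terms being nonnegative, creates no new zero. *)
Lemma exists_pos_plucker (U : set 'M[R]_n) M : flag_open U -> U M ->
  (forall I : {set 'I_n}, 0 <= plucker M I) ->
  exists N, U N /\ forall I : {set 'I_n}, 0 < plucker N I.
Proof.
move=> [Uo Uu _].
have [m mE] : exists m, m = #|[set I : {set 'I_n} | plucker M I == 0]%SET| by eexists.
elim/ltn_ind: m => m IH in M mE * => UM M0.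
have [MP|/existsNP[J /negP MJ]] := pselect (forall I : {set 'I_n}, 0 < plucker M I).
  by exists M.
have {}MJ : plucker M J = 0 by apply/eqP; rewrite eq_le M0 leNgt MJ.
have [J' [JJ' MJ']] := plucker_neq0 (Uu _ UM) (card_set_ord_le J).
have [I [k [l [kl kI lI MI MkI]]]] : exists (I : {set 'I_n}) (k l : 'I_n),
    [/\ l = k.+1 :> nat \/ k = l.+1 :> nat, k \notin I, l \in I,
        plucker M I = 0 & plucker M (tperm k l @: I)%SET != 0].
  (* Otherwise vanishing would be invariant under adjacent moves and would spread from [J] to
     [J']. *)
  apply: contrapT => no; move/negP: MJ'; apply; apply/eqP.
  apply: (adjacent_move_ind (S := fun I => plucker M I = 0)) MJ => // I k l lk kI lI.
  have tK : (tperm k l @: (tperm k l @: I))%SET = I.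
    by rewrite -imset_comp -[RHS]imset_id; apply: eq_imset => x /=; rewrite tpermK.
  have kI' : k \in (tperm k l @: I)%SET.
    by apply/imsetP; exists l => //; rewrite tpermR.
  have lI' : l \notin (tperm k l @: I)%SET.
    apply/imsetP => -[x xI lx]; move: xI.
    suff -> : x = k by rewrite (negbTE kI).
    by apply: (@perm_inj _ (tperm k l)); rewrite -lx tpermL.
  split=> h; apply/eqP; apply: contrapT => /negP h'; apply: no.
    exists (tperm k l @: I)%SET, l, k; split=> //; first by right.
    by rewrite (tpermC l k) tK.
  by exists I, k, l; split=> //; left.
have [a [a0 Ua]] := open_col_add k l Uo UM.
have upd I' := plucker_col_add I' a M kl.
have N0 I' : 0 <= plucker (col_add k l a M) I'.
  by rewrite upd addr_ge0 //; case: ifP => // _; rewrite mulr_ge0 // ltW.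
apply: (IH _ _ (col_add k l a M) erefl) => //; rewrite mE.
apply: proper_card; apply/properP; split.
  apply/fintype.subsetP => I'; rewrite !inE upd => /eqP h.
  by rewrite eq_le M0 andbT -h lerDl; case: ifP => // _; rewrite mulr_ge0 // ltW.
exists I; rewrite inE ?MI // upd MI add0r kI lI /= mulf_neq0 //.
by rewrite gt_eqF.
Qed.

End Flags.

(** * Equality of the closure with the nonnegative locus *)

Theorem theorem3 (R : realType) (n : nat) (hn : (2 <= n)%N)
  (w : seq nat) (hw : reduced_word_w0 n w)
  (M : 'M[R]_n) (hM : M \in unitmx) :
  tnn_flag w M <-> nonneg_plucker M.
Proof.
split=> [tnnM|[N [MN N0]] U Uo UM].
  apply: nonneg_plucker_of_mul_ge0 => I J IJ; rewrite leNgt; apply/negP => MIJ.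
  have [|u [uw]] := tnnM _ (flag_open_plucker_lt0 R IJ) _.
    by rewrite /= pmulr_rlt0 // exprn_even_gt0 //= -unitfE -unitmxE.
  case: hw => wP _ _; rewrite /= ltNge mulr_ge0 ?sqr_ge0 // mulr_ge0 //;
    exact: plucker_Uplus_ge0 wP uw.
(* Saturation lets the nonnegative representative [N] replace [M] in the neighbourhood. *)
have [_ _ Usat] := Uo; have UN := Usat _ _ MN UM.
have [N' [UN' N'0]] := exists_pos_plucker Uo UN N0.
have [|L [Lt Lu LN']] := @neville_factorization R n N'.
  move=> d h f j fj; rewrite minor_plucker // => x y xy.
  by rewrite !fj ltn_add2l.
exists (L *m N'); split; last by apply: Usat UN'; exists L.
(* The factorization follows the staircase word; it is transferred to the given word [w]. *)
rewrite (Uplus_pos_reduced_eq R (reduced_word_w0_reduced hw)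
  (reduced_word_w0_reduced (reduced_staircase_word n))).
exact: LN'.
Qed.
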